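(* Let $t\ge 1$ be an integer. Then $\chi_p(P_{3t}\Diamond_3 C_5)=4$ if $t=1$, and $\chi_p(P_{3t}\Diamond_3 C_5)=5$ if $t\ge 2$.
   Context: A packing $k$-coloring of a graph $H$ is a map $c:V(H)\to\{1,\ldots,k\}$ such that any two distinct vertices $u,v$ with $c(u)=c(v)=i$ satisfy $d_H(u,v)\ge i+1$. The packing chromatic number $\chi_p(H)$ is the least such $k$. $P_m$ denotes the path $v_1\cdots v_m$ and $C_n$ the cycle on $n$ vertices. Path-aligned product: for positive integers $\ell\mid m$ and a connected vertex-transitive graph $G$ containing $P_\ell$ as a subgraph, $P_m\Diamond_\ell G$ is formed from the path $P_m=v_1\cdots v_m$ and $m/\ell$ pairwise disjoint copies of $G$, where for each $1\le i\le m/\ell$ the consecutive path vertices $v_{(i-1)\ell+1},\ldots,v_{i\ell}$ are identified, in order, with the vertices of a path $P_\ell$ (i.e. $\ell$ consecutive cycle vertices when $G$ is a cycle) in the $i$-th copy of $G$. *)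

(* Defs.v *)
From mathcomp Require Import all_boot.

Set Implicit Arguments.
Unset Strict Implicit.
Unset Printing Implicit Defensive.

Section Distance.

Variables (T : finType) (e : rel T).

Definition walk_of_length (n : nat) (x y : T) : bool :=
  [exists w : n.-tuple T, path e x w && (last x w == y)].

(* A shortest walk has fewer than #|T| edges.  The value is only meaningful   *)
(* when connect e x y holds; across components the distance is infinite.      *)
Definition gdist (x y : T) : nat :=
  find (fun n => walk_of_length n x y) (iota 0 #|T|).

Lemma gdistP x y : connect e x y ->
  walk_of_length (gdist x y) x y /\
  (forall n, walk_of_length n x y -> gdist x y <= n).
Proof.
move=> /connectP[w0 /shortenP[w ew uw _] ->] {w0}.
set y' := last x w.
have lw : size w < #|T| by rewrite (leq_trans _ (max_card (mem (x :: w)))) ?(card_uniqP uw).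
have hw : walk_of_length (size w) x y'.
  by apply/existsP; exists (in_tuple w); rewrite ew eqxx.
have hs : has (fun n => walk_of_length n x y') (iota 0 #|T|).
  by apply/hasP; exists (size w); rewrite ?mem_iota.
split=> [|n hn].
  have := nth_find 0 hs; rewrite nth_iota //.
  by move: hs; rewrite has_find size_iota.
rewrite leqNgt; apply/negP => ltn.
have := before_find 0 ltn; rewrite nth_iota ?hn //.
by apply: leq_trans ltn _; rewrite -[leqRHS](size_iota 0) find_size.
Qed.

End Distance.

Section PackingColoring.

Variables (T : finType) (e : rel T).

(* The element i : 'I_k stands for the colour i.+1, so that the colours are   *)
(* 1, ..., k; vertices in different components are at infinite distance.      *)
Definition packing_coloring (k : nat) (c : {ffun T -> 'I_k}) : bool :=
  [forall x, forall y,
    [&& x != y, c x == c y & connect e x y] ==> ((c x).+1.+1 <= gdist e x y)].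

Definition packing_colorable (k : nat) : bool :=
  [exists c : {ffun T -> 'I_k}, packing_coloring c].

Lemma packing_colorable_exists : exists k, packing_colorable k.
Proof.
exists #|T|; apply/existsP; exists [ffun x => enum_rank x].
apply/forallP => x; apply/forallP => y; rewrite !ffunE.
by rewrite (inj_eq enum_rank_inj); case: eqP.
Qed.

Definition packing_chromatic : nat := ex_minn packing_colorable_exists.

End PackingColoring.

(* The cycle on n vertices, for n >= 3.                                       *)
Definition cycle_graph (n : nat) : rel 'I_n :=
  [rel i j : 'I_n | (i.+1 %% n == j) || (j.+1 %% n == i)].

Arguments cycle_graph n : clear implicits.

Definition path_in (T : finType) (e : rel T) (ell : nat) (p : ell.-tuple T) :=
  uniq p && sorted e p.

Section PathAlignedProduct.

(* The vertex (i, x) is the vertex x of the i-th copy of (T, e), copies being *)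
(* numbered from 0, and p i is the path of the i-th copy along which the path *)
(* on m vertices is glued.  Since ell divides m, every vertex of that path is *)
(* identified with a vertex of some copy, so there are no further vertices.   *)
Variables (m ell : nat) (T : finType) (e : rel T).
Variable p : 'I_(m %/ ell) -> ell.-tuple T.

(* u is identified with the k-th path vertex, path vertices being numbered    *)
(* from 0.                                                                    *)
Definition glued (k : nat) (u : 'I_(m %/ ell) * T) : bool :=
  (k %/ ell == u.1) && (onth (p u.1) (k %% ell) == Some u.2).

Definition path_step (u v : 'I_(m %/ ell) * T) : bool :=
  [exists k : 'I_m, [&& k.+1 < m, glued k u & glued k.+1 v]].

Definition path_aligned_product : rel ('I_(m %/ ell) * T) :=
  [rel u v | [|| (u.1 == v.1) && e u.2 v.2, path_step u v | path_step v u]].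

End PathAlignedProduct.

(* Main.v *)
Require Import Defs.
From mathcomp Require Import all_boot zify.

Set Implicit Arguments.
Unset Strict Implicit.
Unset Printing Implicit Defensive.

(** Label the vertices of every copy of C_5 by 0, ..., 4 around the cycle so
    that the glued path is 0, 1, 2; the vertex 2 of a copy is then adjacent to
    the vertex 0 of the next one, and distances have a closed form.  A copy has
    diameter 2, so colour 1 occurs on it at most twice and the others at most
    once: three colours never suffice, and with four colours every copy uses 1
    twice and 2, 3, 4 once.  The last is impossible on two consecutive copies,
    which is a finite check.  Alternating the words 12413 and 12513 along the
    copies gives a packing 5-colouring. *)

Section Walks.

Variables (T : finType) (e : rel T).

Lemma walk_ofP n x y :
  reflect (exists s, [/\ size s = n, path e x s & last x s = y])
    (walk_of_length e n x y).
Proof.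
apply: (iffP existsP) => [[w /andP[pw /eqP lw]]|[s [sz ps ls]]].
  by exists w; rewrite size_tuple.
have szb : size s == n by apply/eqP.
by exists (Tuple szb); rewrite /= ps ls eqxx.
Qed.

Lemma walk_of0 x : walk_of_length e 0 x x.
Proof. by apply/walk_ofP; exists [::]. Qed.

Lemma walk_of1 x y : e x y -> walk_of_length e 1 x y.
Proof. by move=> exy; apply/walk_ofP; exists [:: y]; rewrite /= exy. Qed.

Lemma walk_of_cat n m x y z :
  walk_of_length e n x y -> walk_of_length e m y z ->
  walk_of_length e (n + m) x z.
Proof.
move=> /walk_ofP[s [<- ps ls]] /walk_ofP[r [<- pr lr]].
by apply/walk_ofP; exists (s ++ r); rewrite size_cat cat_path last_cat ls ps pr.
Qed.

Lemma packing_coloring_walk k (c : {ffun T -> 'I_k}) n x y :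
  packing_coloring e c -> x != y -> walk_of_length e n x y ->
  c x = c y -> (c x).+1 < n.
Proof.
move=> /forallP/(_ x)/forallP/(_ y) /implyP pc neq wn cxy.
have cn : connect e x y.
  by have /walk_ofP[s [_ ps <-]] := wn; apply/connectP; exists s.
have [_ /(_ n wn)] := gdistP cn.
by apply: leq_trans; apply: pc; rewrite neq cxy eqxx.
Qed.

Lemma packing_chromaticE k :
  packing_colorable e k -> (forall l, packing_colorable e l -> k <= l) ->
  packing_chromatic e = k.
Proof.
rewrite /packing_chromatic => ck mk; case: ex_minnP => l cl ml.
by apply/eqP; rewrite eqn_leq ml // mk.
Qed.

End Walks.

Definition cyc5 (x y : nat) : nat := minn ((x + 5 - y) %% 5) ((y + 5 - x) %% 5).

(* Distance from the vertex x of a copy to the vertex y of the d-th copy      *)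
(* after it.                                                                  *)
Definition copy_dist (d x y : nat) : nat :=
  if d is d'.+1 then cyc5 x 2 + 1 + 3 * d' + cyc5 0 y else cyc5 x y.

Definition model_dist (i x j y : nat) : nat :=
  if i <= j then copy_dist (j - i) x y else copy_dist (i - j) y x.

Definition model_adj (i x j y : nat) : bool :=
  [|| (i == j) && (cyc5 x y == 1),
      [&& j == i.+1, x == 2 & y == 0] |
      [&& i == j.+1, x == 0 & y == 2]].

Ltac case5 x := case: x => [|[|[|[|[|x]]]]] //.
Ltac ord5 x := case: x => [[|[|[|[|[|x]]]]] ?] //=.

Lemma cyc5_sym x y : cyc5 x y = cyc5 y x.
Proof. exact: minnC. Qed.

Lemma cyc5_triangle x y z : x < 5 -> y < 5 -> z < 5 ->
  cyc5 x z <= cyc5 x y + cyc5 y z.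
Proof. by case5 x; case5 y; case5 z. Qed.

Lemma cyc5_02 y : y < 5 -> 2 <= cyc5 0 y + cyc5 y 2.
Proof. by case5 y. Qed.

Lemma model_dist_bridge i x j : x < 5 ->
  model_dist i x j.+1 0 <= (model_dist i x j 2).+1 /\
  model_dist i x j 2 <= (model_dist i x j.+1 0).+1.
Proof.
move=> /cyc5_02; rewrite /model_dist /copy_dist.
have c22 : cyc5 2 2 = 0 by [].
have c02 : cyc5 0 2 = 2 by [].
have c00 : cyc5 0 0 = 0 by [].
case: (leqP i j) => ij.
  rewrite (leqW ij) subSn //.
  by case: (j - i) => [|d]; rewrite ?c00 ?c02; lia.
case E: (i - j) => [|d]; first lia.
have -> : (i <= j.+1) = (d == 0) by lia.
case: eqP E => [-> E|dn E].
  have -> : j.+1 - i = 0 by lia.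
  by rewrite c22 (cyc5_sym x 0); lia.
have -> : i - j.+1 = d.-1.+1 by lia.
by rewrite c22 c02; lia.
Qed.

Lemma model_dist_adj i x j y k z : x < 5 -> y < 5 -> z < 5 ->
  model_adj j y k z -> model_dist i x k z <= (model_dist i x j y).+1.
Proof.
move=> hx hy hz; rewrite /model_adj; case/or3P.
- case/andP => /eqP <- /eqP yz.
  have := cyc5_triangle hx hy hz; have := @cyc5_triangle 0 y z isT hy hz.
  have := @cyc5_triangle z y 2 hz hy isT.
  rewrite (cyc5_sym z y) yz /model_dist /copy_dist.
  case: (leqP i j) => ij; first by case: (j - i) => [|d]; lia.
  by case E: (i - j) => [|d]; lia.
- by case/and3P => /eqP -> /eqP -> /eqP ->; case: (model_dist_bridge i j hx).
- by case/and3P => /eqP -> /eqP -> /eqP ->; case: (model_dist_bridge i k hx).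
Qed.

Definition upward (q : 3.-tuple 'I_5) : bool :=
  (tnth q ord0).+1 %% 5 == tnth q (inord 1).

Definition label (q : 3.-tuple 'I_5) (x : 'I_5) : nat :=
  if upward q then (x + 5 - tnth q ord0) %% 5 else (tnth q ord0 + 5 - x) %% 5.

Definition unlabel (q : 3.-tuple 'I_5) (k : nat) : 'I_5 :=
  inord (if upward q then (tnth q ord0 + k) %% 5
         else (tnth q ord0 + 5 - k) %% 5).

Lemma label_lt5 q x : label q x < 5.
Proof. by rewrite /label; case: ifP => _; rewrite ltn_mod. Qed.

Lemma label_inj q : injective (label q).
Proof.
move=> x y; rewrite /label => h; apply: val_inj => /=.
by have := ltn_ord x; have := ltn_ord y; have := ltn_ord (tnth q ord0);
   move: h; case: ifP => _; lia.
Qed.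

Lemma unlabelK q k : k < 5 -> label q (unlabel q k) = k.
Proof.
have := ltn_ord (tnth q ord0); rewrite /label /unlabel => hq hk.
by case: (upward q); rewrite inordK ?ltn_mod //; lia.
Qed.

Lemma label_adj q x y : cycle_graph 5 x y = (cyc5 (label q x) (label q y) == 1).
Proof.
rewrite /label /cycle_graph /=; move: (tnth q ord0) => a.
by case: (upward q); ord5 a; ord5 x; ord5 y.
Qed.

Lemma label_onth q k x : path_in (cycle_graph 5) q -> k < 3 ->
  (onth q k == Some x) = (label q x == k).
Proof.
rewrite /path_in /label /upward => pq hk.
rewrite !(tnth_nth ord0) inordK //=.
case: q pq => [[|a [|b [|c [|]]]]] //= _.
rewrite /cycle_graph /= !inE andbT negb_or => /andP[].
case: k hk => [|[|[|k]]] //= _; rewrite !(inj_eq Some_inj) -!val_eqE /=.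
- by ord5 a; ord5 b; ord5 c; ord5 x.
- by ord5 a; ord5 b; ord5 c; ord5 x.
- by ord5 a; ord5 b; ord5 c; ord5 x.
Qed.

Section Product.

Variables (t : nat) (p : 'I_((3 * t) %/ 3) -> 3.-tuple 'I_5).
Hypothesis hp : forall i, path_in (cycle_graph 5) (p i).

Local Notation V := ('I_((3 * t) %/ 3) * 'I_5)%type.
Local Notation G := (path_aligned_product (cycle_graph 5) p).

Definition vlabel (u : V) : nat := label (p u.1) u.2.

Lemma gluedE k u : glued p k u = (k == 3 * u.1 + vlabel u) && (vlabel u < 3).
Proof.
rewrite /glued label_onth ?ltn_mod // -/(vlabel u).
by move: (vlabel u) => l; lia.
Qed.

Lemma path_stepE u v : path_step p u v =
  [&& vlabel u < 3, vlabel v < 3 & 3 * v.1 + vlabel v == (3 * u.1 + vlabel u).+1].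
Proof.
apply/existsP/and3P => [[k /and3P[_]]|[lu lv /eqP E]].
  by rewrite !gluedE => /andP[/eqP <- ->] /andP[/eqP <- ->].
have hv := ltn_ord v.1; have hk : (3 * u.1 + vlabel u).+1 < 3 * t by lia.
by exists (Ordinal (ltnW hk)); rewrite !gluedE /= E lu lv !eqxx hk.
Qed.

Lemma productE u v : G u v = model_adj u.1 (vlabel u) v.1 (vlabel v).
Proof.
rewrite /path_aligned_product /= !path_stepE /model_adj -val_eqE.
case: (eqVneq (val u.1) (val v.1)) => [E|ne] /=.
  have /val_inj E' := E.
  rewrite (label_adj (p u.1)) /vlabel -E'.
  have := label_lt5 (p u.1) u.2; have := label_lt5 (p u.1) v.2.
  move: (label _ _) (label _ _) => x y.
  by case5 x; case5 y; move=> _ _; lia.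
have := label_lt5 (p u.1) u.2; have := label_lt5 (p v.1) v.2.
by rewrite -!/(vlabel _); move: (vlabel u) (vlabel v) ne => x y /eqP /=; lia.
Qed.

Lemma model_dist_walk n u v : walk_of_length G n u v ->
  model_dist u.1 (vlabel u) v.1 (vlabel v) <= n.
Proof.
move=> /walk_ofP[s [<- ps <-]] {n v}.
elim/last_ind: s ps => [_|s v IH].
  by rewrite /= /model_dist leqnn subnn /= /cyc5 minnn addnC addnK modnn.
rewrite rcons_path last_rcons size_rcons => /andP[/IH le].
rewrite productE => adj.
by apply: leq_trans (model_dist_adj _ _ _ _ adj) _; rewrite ?label_lt5.
Qed.

Lemma product_packing_colorable k (f : nat -> nat -> nat) :
  (forall i x, f i x < k) ->
  (forall i d x y, i + d < t -> x < 5 -> y < 5 -> (d != 0) || (x != y) ->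
     f i x = f (i + d) y -> (f i x).+1 < copy_dist d x y) ->
  packing_colorable G k.
Proof.
move=> fk fP; have st : (3 * t) %/ 3 = t by rewrite mulKn.
apply/existsP; exists [ffun u : V => Ordinal (fk u.1 (vlabel u))].
apply/forallP => u; apply/forallP => v; rewrite !ffunE.
apply/implyP => /and3P[nuv /eqP [fuv] cuv] /=.
have [/model_dist_walk le _] := gdistP cuv; apply: leq_trans le.
have ltt (i : 'I_((3 * t) %/ 3)) : i < t by rewrite -[ltnRHS]st.
have hu := ltt u.1; have hv := ltt v.1.
have lu := label_lt5 (p u.1) u.2; have lv := label_lt5 (p v.1) v.2.
have ne : (u.1 != v.1 :> nat) || (vlabel u != vlabel v).
  rewrite -negb_and; apply: contra nuv => /andP[/eqP/val_inj E1].
  by case: u v E1 {fuv cuv hu hv lu lv} => [i x] [j y] /= <- /eqP h; rewrite (label_inj (h : label (p i) x = label (p i) y)).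
rewrite /model_dist; case: (leqP u.1 v.1) => ij.
  have E : u.1 + (v.1 - u.1) = v.1 by rewrite subnKC.
  by apply: fP; rewrite ?E //; move: ne; lia.
have E : v.1 + (u.1 - v.1) = u.1 by rewrite subnKC // ltnW.
by rewrite fuv; apply: fP; rewrite ?E //; move: ne; lia.
Qed.

Definition vert (i : 'I_((3 * t) %/ 3)) (k : nat) : V := (i, unlabel (p i) k).

Lemma vlabel_vert i k : k < 5 -> vlabel (vert i k) = k.
Proof. exact: unlabelK. Qed.

Lemma walk_copy i x y : x < 5 -> y < 5 ->
  walk_of_length G (cyc5 x y) (vert i x) (vert i y).
Proof.
have adj a b : a < 5 -> b < 5 -> cyc5 a b = 1 ->
    walk_of_length G 1 (vert i a) (vert i b).
  move=> ha hb ab; apply: walk_of1.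
  by rewrite productE !vlabel_vert // /model_adj eqxx ab.
have two a b c : a < 5 -> b < 5 -> c < 5 -> cyc5 a b = 1 -> cyc5 b c = 1 ->
    walk_of_length G 2 (vert i a) (vert i c).
  by move=> ha hb hc ab bc; apply: (@walk_of_cat _ _ 1 1 _ (vert i b)); apply: adj.
case5 x; case5 y; move=> _ _; try exact: walk_of0; try exact: adj.
all: by [exact: (two _ 0)|exact: (two _ 1)|exact: (two _ 2)|exact: (two _ 3)|exact: (two _ 4)].
Qed.

Lemma walk_next_copy (i j : 'I_((3 * t) %/ 3)) x y : j = i.+1 :> nat -> x < 5 -> y < 5 ->
  walk_of_length G (copy_dist 1 x y) (vert i x) (vert j y).
Proof.
move=> ij hx hy; rewrite /copy_dist muln0 addn0.
apply: walk_of_cat (walk_copy j _ hy) => //.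
apply: walk_of_cat (walk_copy i hx _) _ => //.
by apply: walk_of1; rewrite productE !vlabel_vert // /model_adj /= ij !eqxx orbT.
Qed.

End Product.

Definition compatible (d : nat) (s r : seq nat) : bool :=
  all (fun x => all (fun y =>
      [|| (d == 0) && (x == y), nth 0 s x != nth 0 r y |
          (nth 0 s x).+1 < copy_dist d x y])
    (iota 0 5)) (iota 0 5).

Fixpoint words (n k : nat) : seq (seq nat) :=
  if n is n'.+1 then [seq a :: s | a <- iota 0 k, s <- words n' k]
  else [:: [::]].

Lemma mem_words n k s : size s = n -> all (fun a => a < k) s -> s \in words n k.
Proof.
elim: n s => [|n IH] [|a s] //= [sz] /andP[ak sk].
by apply: allpairs_f; rewrite ?mem_iota ?IH.
Qed.

Lemma no_copy_3 : all (fun s => ~~ compatible 0 s s) (words 5 3).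
Proof. by vm_compute. Qed.

Lemma no_two_copies_4 :
  let L := [seq s <- words 5 4 | compatible 0 s s] in
  all (fun s => all (fun r => ~~ compatible 1 s r) L) L.
Proof. by vm_compute. Qed.

Section LowerBound.

Variables (t : nat) (p : 'I_((3 * t) %/ 3) -> 3.-tuple 'I_5).
Hypothesis hp : forall i, path_in (cycle_graph 5) (p i).
Local Notation G := (path_aligned_product (cycle_graph 5) p).
Variables (k : nat) (c : {ffun 'I_((3 * t) %/ 3) * 'I_5 -> 'I_k}).
Hypothesis pc : packing_coloring G c.

Definition copy_word i : seq nat := mkseq (fun x => c (vert p i x) : nat) 5.

Lemma copy_word_words l i : k <= l -> copy_word i \in words 5 l.
Proof.
move=> kl; apply: mem_words; first by rewrite size_mkseq.
apply/allP => a /mapP[x _ ->]; exact: leq_trans (ltn_ord _) kl.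
Qed.

Lemma copy_word_compatible0 i : compatible 0 (copy_word i) (copy_word i).
Proof.
apply/allP => x; rewrite mem_iota => hx; apply/allP => y.
rewrite mem_iota => hy; rewrite !nth_mkseq //=.
case: (eqVneq x y) => //= xy; case: eqVneq => //= /val_inj cxy.
apply: (packing_coloring_walk pc _ (walk_copy hp i hx hy) cxy).
apply: contra xy => /eqP/(congr1 (vlabel p)).
by rewrite !vlabel_vert // => ->.
Qed.

Lemma copy_word_compatible1 (i j : 'I_((3 * t) %/ 3)) : j = i.+1 :> nat ->
  compatible 1 (copy_word i) (copy_word j).
Proof.
move=> ij; apply/allP => x; rewrite mem_iota => hx; apply/allP => y.
rewrite mem_iota => hy; rewrite !nth_mkseq //=.
case: eqVneq => //= /val_inj cxy.
apply: (packing_coloring_walk pc _ (walk_next_copy hp ij hx hy) cxy).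
by apply/eqP => -[E _]; move: ij; rewrite E; lia.
Qed.

Lemma product_colors_gt3 : 0 < t -> 3 < k.
Proof.
move=> t0; have h0 : 0 < (3 * t) %/ 3 by rewrite mulKn.
rewrite ltnNge; apply/negP => k3.
have /negP[] := allP no_copy_3 _ (copy_word_words (Ordinal h0) k3).
exact: copy_word_compatible0.
Qed.

Lemma product_colors_gt4 : 1 < t -> 4 < k.
Proof.
move=> t1; have h1 : 1 < (3 * t) %/ 3 by rewrite mulKn.
rewrite ltnNge; apply/negP => k4.
have inL i : copy_word i \in [seq s <- words 5 4 | compatible 0 s s].
  by rewrite mem_filter copy_word_compatible0 copy_word_words.
have /allP/(_ _ (inL (Ordinal h1)))/negP[] :=
  allP no_two_copies_4 _ (inL (Ordinal (ltnW h1))).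
exact: copy_word_compatible1.
Qed.

End LowerBound.

(* The colour a.+1 is written a, so these are the words 12134, 12413 and 12513. *)
Definition coloring4 (i x : nat) : nat := nth 0 [:: 0; 1; 0; 2; 3] x.

Definition coloring5 (i x : nat) : nat :=
  nth 0 (if odd i then [:: 0; 1; 4; 0; 2] else [:: 0; 1; 3; 0; 2]) x.

Lemma coloring4P i d x y : i + d < 1 -> x < 5 -> y < 5 -> (d != 0) || (x != y) ->
  coloring4 i x = coloring4 (i + d) y -> (coloring4 i x).+1 < copy_dist d x y.
Proof. by case: d => [|d]; last lia; case5 x; case5 y. Qed.

Lemma coloring5P i d x y : x < 5 -> y < 5 -> (d != 0) || (x != y) ->
  coloring5 i x = coloring5 (i + d) y -> (coloring5 i x).+1 < copy_dist d x y.
Proof.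
rewrite /coloring5 oddD; case: (odd i).
  case: d => [|[|[|d]]]; rewrite /= ?negbK; case: (odd _) => /=;
  by case5 x; case5 y; rewrite /copy_dist ?mulnS.
case: d => [|[|[|d]]]; rewrite /= ?negbK; case: (odd _) => /=;
by case5 x; case5 y; rewrite /copy_dist ?mulnS.
Qed.

Theorem theorem5 (t : nat) (ht : 1 <= t)
    (p : 'I_((3 * t) %/ 3) -> 3.-tuple 'I_5)
    (hp : forall i, path_in (cycle_graph 5) (p i)) :
  (t = 1 -> packing_chromatic (path_aligned_product (cycle_graph 5) p) = 4) /\
  (2 <= t -> packing_chromatic (path_aligned_product (cycle_graph 5) p) = 5).
Proof.
split=> [t1|t2]; apply: packing_chromaticE.
- apply: (product_packing_colorable hp (f := coloring4)).
    by move=> i x; case5 x; rewrite /coloring4 nth_default.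
  by move=> i d x y; rewrite t1; apply: coloring4P.
- by move=> k /existsP[c pc]; apply: product_colors_gt3 pc ht.
- apply: (product_packing_colorable hp (f := coloring5)).
    by move=> i x; rewrite /coloring5; case: ifP => _; case5 x; rewrite nth_default.
  by move=> i d x y _; apply: coloring5P.
- by move=> k /existsP[c pc]; apply: product_colors_gt4 pc t2.
Qed.
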